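(* The following equality holds: $$\inf_{x\in\mathcal X}P_0(x)=\inf_{\mu\in[\mu_0,\delta^{-1}]}\ \inf_{x\in\mathcal X_\mu}P_\mu(x).$$
   Context: Data: $n,m\ge 1$; $B\in\mathbb R^{m\times n}$; $Q\in\mathbb R^{n\times n}$ symmetric; $H\in\mathbb R^{n\times n}$ (symmetric) negative definite; $\lambda\in\mathbb R$, $\lambda>0$; $f,b\in\mathbb R^n$. $|\cdot|$ is the Euclidean norm. Define, for $x\in\mathbb R^n$, $$g(x)=\tfrac12\left(\tfrac12|Bx|^2-\lambda\right)^2,\qquad h(x)=\tfrac12x^THx-b^Tx .$$ Assume $h(H^{-1}b)>0$, define $\mu_0>0$ by $\mu_0^{-1}=h(H^{-1}b)$, and fix $\delta\in(0,\mu_0^{-1}]$. Let $$\mathcal X=\{x\in\mathbb R^n:h(x)\ge\delta\},\qquad P_0(x)=\tfrac12x^TQx-f^Tx+\frac{g(x)}{h(x)}\quad(x\in\mathcal X),$$ and for $\mu\in[\mu_0,\delta^{-1}]$ let $$\mathcal X_\mu=\{x\in\mathbb R^n: h(x)\ge\mu^{-1}\},\qquad P_\mu(x)=\tfrac12x^TQx-f^Tx+\mu g(x).$$ *)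

(* Defs.v *)
(* MathComp / MathComp-Analysis; the real line is an arbitrary R : realType. *)
From mathcomp Require Import all_boot all_order all_algebra.
From mathcomp Require Import all_classical all_reals all_analysis.
Set Implicit Arguments.
Unset Strict Implicit.
Unset Printing Implicit Defensive.
Import Order.TTheory GRing.Theory Num.Theory.
Local Open Scope classical_set_scope.
Local Open Scope ring_scope.

Section CanonicalDuality.
Variables (R : realType) (n m : nat).

(* Not `|x|, which on matrices denotes the max norm. *)
Definition enorm (k : nat) (x : 'cV[R]_k) : R :=
  Num.sqrt (\sum_(i < k) x i 0 ^+ 2).

(* The products below are 1 x 1 matrices; (_ 0 0) extracts the scalar. *)
Definition dotv (u v : 'cV[R]_n) : R := (u^T *m v) 0 0.

Definition quadf (A : 'M[R]_n) (x : 'cV[R]_n) : R := (x^T *m A *m x) 0 0.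

Definition symmx (A : 'M[R]_n) : Prop := A^T = A.

Definition negdefmx (A : 'M[R]_n) : Prop :=
  symmx A /\ forall x : 'cV[R]_n, x != 0 -> quadf A x < 0.

Definition gfun (B : 'M[R]_(m, n)) (lambda : R) (x : 'cV[R]_n) : R :=
  2^-1 * (2^-1 * enorm (B *m x) ^+ 2 - lambda) ^+ 2.

Definition hfun (H : 'M[R]_n) (b x : 'cV[R]_n) : R :=
  2^-1 * quadf H x - dotv b x.

Definition mu0 (H : 'M[R]_n) (b : 'cV[R]_n) : R :=
  (hfun H b (invmx H *m b))^-1.

Definition Xset (H : 'M[R]_n) (b : 'cV[R]_n) (delta : R) : set 'cV[R]_n :=
  [set x | delta <= hfun H b x].

Definition P0 (B : 'M[R]_(m, n)) (Q H : 'M[R]_n) (lambda : R)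
    (f b x : 'cV[R]_n) : R :=
  2^-1 * quadf Q x - dotv f x + gfun B lambda x / hfun H b x.

Definition Xmu (H : 'M[R]_n) (b : 'cV[R]_n) (mu : R) : set 'cV[R]_n :=
  [set x | mu^-1 <= hfun H b x].

Definition Pmu (B : 'M[R]_(m, n)) (Q : 'M[R]_n) (lambda : R)
    (f : 'cV[R]_n) (mu : R) (x : 'cV[R]_n) : R :=
  2^-1 * quadf Q x - dotv f x + mu * gfun B lambda x.

End CanonicalDuality.

(* Main.v *)
(* Completing the square gives h(x) <= h(H^{-1} b) = 1 / mu_0, so mu = 1 / h(x)
   is admissible for every x in X, and P_mu(x) = P_0(x) for that mu.
   Conversely, x in X_mu forces 1 / h(x) <= mu, whence P_0(x) <= P_mu(x)
   because g >= 0. *)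
Require Import Defs.
From mathcomp Require Import all_boot all_order all_algebra.
From mathcomp Require Import all_classical all_reals all_analysis.
From mathcomp Require Import ring.
Set Implicit Arguments.
Unset Strict Implicit.
Unset Printing Implicit Defensive.
Import Order.TTheory GRing.Theory Num.Theory.
Local Open Scope classical_set_scope.
Local Open Scope ring_scope.

(** A nonzero row vector [v] in the left kernel of [H] would give [quadf H v^T = 0], against
    negative definiteness. *)
Lemma negdefmx_unit (R : realType) (n : nat) (H : 'M[R]_n) :
  negdefmx H -> H \in unitmx.
Proof.
move=> [_ Hneg]; rewrite -row_free_unit -kermx_eq0.
apply/negPn/negP => /rowV0Pn[v /sub_kermxP vH v_neq0].
have := Hneg v^T; rewrite trmx_eq0 => /(_ v_neq0).
by rewrite /quadf trmxK vH mul0mx mxE ltxx.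
Qed.

Lemma dotvC (R : realType) (n : nat) (u v : 'cV[R]_n) : dotv u v = dotv v u.
Proof. by rewrite /dotv -[v in LHS]trmxK -trmx_mul mxE. Qed.

(** Since [c] is a critical point of [h], no term linear in [y] survives: by symmetry of [H] both
    cross terms equal [dotv b y], and half their sum cancels the contribution of
    [- dotv b (c + y)]. *)
Lemma hfun_complete_square (R : realType) (n : nat) (H : 'M[R]_n)
    (b c y : 'cV[R]_n) :
  symmx H -> H *m c = b -> hfun H b (c + y) = hfun H b c + 2^-1 * quadf H y.
Proof.
move=> Hsym Hc.
have quadD : quadf H (c + y) = quadf H c + dotv b y *+ 2 + quadf H y.
  have cHy : (c^T *m H *m y) 0 0 = dotv b y.
    by rewrite /dotv -Hc trmx_mul Hsym.
  have yHc : (y^T *m H *m c) 0 0 = dotv b y.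
    by rewrite dotvC /dotv -mulmxA Hc.
  rewrite /quadf [(c + y)^T]linearD /= !mulmxDl !mulmxDr.
  rewrite [LHS]mxE [X in X + _]mxE [X in _ + X]mxE.
  by rewrite cHy yHc; ring.
rewrite /hfun quadD.
have -> : dotv b (c + y) = dotv b c + dotv b y.
  by rewrite /dotv mulmxDr mxE.
by field.
Qed.

Lemma hfun_le_max (R : realType) (n : nat) (H : 'M[R]_n) (b x : 'cV[R]_n) :
  negdefmx H -> hfun H b x <= hfun H b (invmx H *m b).
Proof.
move=> Hneg; have [Hsym Hlt0] := Hneg.
set c := invmx H *m b.
have Hc : H *m c = b by rewrite mulKVmx // negdefmx_unit.
rewrite -(subrKC c x) (hfun_complete_square _ Hsym Hc) gerDl.
(* Strict negativity is only available for nonzero vectors, so [x = c] is treated apart. *)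
have [->|/Hlt0 lt0] := eqVneq (x - c) 0.
  by rewrite /quadf mulmx0 mxE mulr0.
by rewrite mulr_ge0_le0 ?invr_ge0 // ltW.
Qed.

Lemma gfun_ge0 (R : realType) (n m : nat) (B : 'M[R]_(m, n)) (lambda : R)
  (x : 'cV[R]_n) : 0 <= gfun B lambda x.
Proof. by rewrite /gfun mulr_ge0 ?invr_ge0 // sqr_ge0. Qed.

Theorem lemma1 (R : realType) (n m : nat) (n_ge1 : (1 <= n)%N)
    (m_ge1 : (1 <= m)%N) (B : 'M[R]_(m, n)) (Q H : 'M[R]_n) (lambda : R)
    (f b : 'cV[R]_n) (delta : R)
    (Qsym : symmx Q) (Hneg : negdefmx H) (lambda_gt0 : 0 < lambda)
    (hmax_gt0 : 0 < hfun H b (invmx H *m b))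
    (delta_gt0 : 0 < delta) (delta_le : delta <= (mu0 H b)^-1) :
  ereal_inf [set (P0 B Q H lambda f b x)%:E | x in Xset H b delta] =
  ereal_inf [set ereal_inf [set (Pmu B Q lambda f mu x)%:E | x in Xmu H b mu]
            | mu in `[mu0 H b, delta^-1]].
Proof.
apply/eqP; rewrite eq_le; apply/andP; split.
- apply: le_ereal_inf_tmp => _ [mu /= + <-].
  rewrite in_itv /= => /andP[mu0_le mu_le].
  have mu_gt0 : 0 < mu by apply: lt_le_trans mu0_le; rewrite /mu0 invr_gt0.
  apply: le_ereal_inf_tmp => _ [x /= mu_hx <-].
  have hx_gt0 : 0 < hfun H b x by apply: lt_le_trans mu_hx; rewrite invr_gt0.
  apply: (@le_trans _ _ (P0 B Q H lambda f b x)%:E).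
    apply: ereal_inf_lbound; exists x => //=.
    (* The upper bound on [mu] makes [Xmu] a subset of [Xset]: [delta <= mu^-1 <= h(x)]. *)
    by apply: le_trans mu_hx; rewrite -[delta]invrK lef_pV2 // posrE invr_gt0.
  rewrite lee_fin /P0 /Pmu lerD2l mulrC ler_wpM2r ?gfun_ge0 //.
  by rewrite -[mu]invrK lef_pV2 // posrE invr_gt0.
- apply: le_ereal_inf_tmp => _ [x /= delta_hx <-].
  have hx_gt0 : 0 < hfun H b x by apply: lt_le_trans delta_hx.
  pose mu := (hfun H b x)^-1.
  apply: (@le_trans _ _
    (ereal_inf [set (Pmu B Q lambda f mu y)%:E | y in Xmu H b mu])).
    apply: ereal_inf_lbound; exists mu => //=.
    (* Inverting [delta <= h(x) <= h(H^-1 b)], all terms being positive, gives both endpoint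
       conditions on [mu]. *)
    by rewrite in_itv /= /mu0 /mu !lef_pV2 ?posrE // delta_hx hfun_le_max.
  (* The constraint of [Xmu] is tight at [x], as [mu^-1] is exactly [h(x)]. *)
  apply: ereal_inf_lbound; exists x; first by rewrite /Xmu /= /mu invrK.
  by rewrite /P0 /Pmu /mu [(hfun _ _ _)^-1 * _]mulrC.
Qed.
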